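(* Let $m$ and $n$ be even positive integers. Then there exist a smooth $(m\times n)$-transportation polytope $T_{rc}$ and a term order $\prec$ such that the reduced Gröbner basis of the toric ideal $I_{T_{rc}}$ with respect to $\prec$ has degree at least $$\frac{m\cdot n}{2}-m=\frac{m(n-2)}{2}.$$
   Context: $\mathbb{N}=\{0,1,2,\dots\}$, $k$ is a field. Transportation polytope: for $r\in\mathbb{N}^m$, $c\in\mathbb{N}^n$, $$T_{rc}=\Big\{A\in\mathbb{R}_{\ge0}^{m\times n}\ \Big|\ \sum_{i=1}^m a_{ij}=c_j\ \forall j,\ \sum_{j=1}^n a_{ij}=r_i\ \forall i\Big\}.$$ It is a lattice polytope. Smoothness: for a polytope $P\subseteq\mathbb{R}^N$ and a vertex $v$, the normal cone is $\mathcal{N}_v(P)=\{\varphi\in(\mathbb{R}^N)^*\mid \varphi(v)=\min_{x\in P}\varphi(x)\}$. Two rational polyhedral cones $\sigma\subseteq\mathbb{R}^N$, $\sigma'\subseteq\mathbb{R}^{N'}$ are lattice equivalent if there is a linear map $\mathbb{R}^N\to\mathbb{R}^{N'}$ mapping $\sigma$ bijectively onto $\sigma'$ and restricting to a lattice isomorphism $\mathbb{Z}^N\cap\operatorname{lin}(\sigma)\to\mathbb{Z}^{N'}\cap\operatorname{lin}(\sigma')$. A $d$-dimensional cone is unimodular if it is lattice equivalent to $\mathbb{R}_{\ge0}^q\times\mathbb{R}^{d-q}$ for some $0\le q\le d$. $P$ is smooth if the normal cone (with respect to the dual lattice $(\mathbb{Z}^N)^*$) at every vertex is unimodular. Toric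 ideal: for a lattice polytope $P\subseteq\mathbb{R}^N$ put $\mathcal{A}=P\cap\mathbb{Z}^N$. The toric ideal $I_P$ is the kernel of the $k$-algebra homomorphism $k[x_a : a\in\mathcal{A}]\to k[t_1^{\pm1},\dots,t_N^{\pm1}]$, $x_a\mapsto t^a$. The degree of a Gröbner basis is the maximum degree of its elements (taken to be $0$ if it is empty). *)

(* Defs.v *)
From mathcomp Require Import all_boot all_order all_algebra finmap.
From mathcomp Require Import boolp classical_sets functions reals.
From mathcomp.multinomials Require Import monalg.
(* monalg and mpoly declare clashing notations: only the ring structures of
   mpoly are imported. *)
From mathcomp.multinomials Require mpoly.
Import (canonicals) mpoly.

Set Implicit Arguments.
Unset Strict Implicit.
Unset Printing Implicit Defensive.

Import GRing.Theory Num.Theory.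

Local Open Scope classical_set_scope.
Local Open Scope ring_scope.

Section Polytopes.
Context {R : realType}.

(* R^N is 'rV[R]_N.  A linear form on R^N is represented by its coordinate
   vector in the dual basis, so that (Z^N)^* is again the set of vectors with
   integer coordinates. *)
Definition pairing (N : nat) (phi x : 'rV[R]_N) : R :=
  \sum_(i < N) phi 0 i * x 0 i.

Definition int_lattice (N : nat) : set 'rV[R]_N :=
  [set x | exists a : 'rV[int]_N, x = map_mx intr a].

Definition lin (N : nat) (sigma : set 'rV[R]_N) : set 'rV[R]_N :=
  [set x | exists2 s : seq 'rV[R]_N,
     (forall y, y \in s -> sigma y) & x \in <<s>>%VS].

Definition has_dim (N : nat) (sigma : set 'rV[R]_N) (d : nat) : Prop :=
  exists2 b : d.-tuple 'rV[R]_N, free b & lin sigma = [set x | x \in <<b>>%VS].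

(* A linear map is additive, so a bijection between the two lattices is
   automatically an isomorphism of groups. *)
Definition lattice_equivalent (N N' : nat)
    (sigma : set 'rV[R]_N) (sigma' : set 'rV[R]_N') : Prop :=
  exists2 L : {linear 'rV[R]_N -> 'rV[R]_N'},
    set_bij sigma sigma' L
  & set_bij (@int_lattice N `&` lin sigma) (@int_lattice N' `&` lin sigma') L.

(* R_{>=0}^q x R^{d-q} *)
Definition standard_cone (d q : nat) : set 'rV[R]_d :=
  [set x | forall i : 'I_d, (i < q)%N -> 0 <= x 0 i].

Definition unimodular (N : nat) (sigma : set 'rV[R]_N) : Prop :=
  exists d q : nat, [/\ (q <= d)%N, has_dim sigma d
    & lattice_equivalent sigma (@standard_cone d q)].

(* A vertex is a zero-dimensional face: the unique minimiser of some linear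
   form. *)
Definition vertex (N : nat) (P : set 'rV[R]_N) (v : 'rV[R]_N) : Prop :=
  P v /\ exists phi : 'rV[R]_N,
    forall x, P x -> x <> v -> pairing phi v < pairing phi x.

Definition normal_cone (N : nat) (P : set 'rV[R]_N) (v : 'rV[R]_N) :
    set 'rV[R]_N :=
  [set phi | forall x, P x -> pairing phi v <= pairing phi x].

Definition smooth (N : nat) (P : set 'rV[R]_N) : Prop :=
  forall v, vertex P v -> unimodular (normal_cone P v).

(* The type of lattice points of P, i.e. of the elements of P \cap Z^N. *)
Definition lattice_pt (N : nat) (P : set 'rV[R]_N) : choiceType :=
  {a : 'rV[int]_N | `[< P (map_mx intr a) >]}.

(* R^(m x n) is identified with R^(m * n) by mxvec/vec_mx. *)
Definition transportation_polytope (m n : nat)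
    (r : 'I_m -> nat) (c : 'I_n -> nat) : set 'rV[R]_(m * n) :=
  [set x | let A := vec_mx x : 'M[R]_(m, n) in
    [/\ forall i j, 0 <= A i j,
        forall j, \sum_(i < m) A i j = (c j)%:R
      & forall i, \sum_(j < n) A i j = (r i)%:R]].

End Polytopes.

Section ToricIdeal.
Context {R : realType} (k : fieldType) (N : nat) (P : set 'rV[R]_N).

(* k[x_a : a in P \cap Z^N], the variables being indexed by the lattice points
   themselves. *)
Definition toric_ring : comNzRingType := {malg k[{cmonom (lattice_pt P)}]}.

(* The field k(t_1, ..., t_N) of rational functions, in which the Laurent
   polynomial ring k[t_1^{+-1}, ..., t_N^{+-1}] is a subring; enlarging the
   codomain does not change the kernel. *)
Definition rational_functions : fieldType :=
  {fraction (mpoly.mpoly N k)}.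

Definition laurent_const (a : k) : rational_functions :=
  FracField.tofrac (mpoly.mpolyC N a).

(* t^a = \prod_i t_i^(a_i), with integer exponents *)
Definition laurent_monom (a : 'rV[int]_N) : rational_functions :=
  \prod_(i < N)
    (FracField.tofrac (mpoly.mpolyX k (mpoly.mnm1 i)) : rational_functions)
    ^ (a 0 i).

(* the image \prod_a (t^a)^(u_a) of the monomial x^u *)
Definition monom_image (u : {cmonom (lattice_pt P)}) : rational_functions :=
  \prod_(a <- finsupp u) laurent_monom (val a) ^+ (u a).

Definition toric_hom : toric_ring -> rational_functions :=
  mmap laurent_const monom_image.

Definition toric_ideal : set toric_ring := [set f | toric_hom f = 0].

End ToricIdeal.

Arguments toric_ring {R} k {N} P.
Arguments toric_ideal {R} k {N} P _.

Section Groebner.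
Context {k : fieldType} {I : choiceType}.
Local Notation monom := {cmonom I}.
Local Notation poly := {malg k[{cmonom I}]}.

(* For finitely many variables such an order is automatically a well-order. *)
Definition term_order (le : rel monom) : Prop :=
  [/\ antisymmetric le, transitive le, total le,
      forall u, le mone u
    & forall u v w, le u v -> le (mmul u w) (mmul v w)].

(* x^u is the initial monomial of f; the zero polynomial has none. *)
Definition is_initial (le : rel monom) (f : poly) (u : monom) : Prop :=
  u \in msupp f /\ forall v, v \in msupp f -> le v u.

Definition ideal_gen (S : set poly) : set poly :=
  [set f | exists2 s : seq (poly * poly),
     (forall p, p \in s -> S p.2) & f = \sum_(p <- s) p.1 * p.2].

Definition initial_ideal (le : rel monom) (S : set poly) : set poly :=
  ideal_gen [set h | exists f u, [/\ S f, is_initial le f u & h = << u >>]].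

Definition groebner_basis (le : rel monom) (J : set poly) (G : {fset poly}) :
    Prop :=
  (forall g, g \in G -> J g) /\
  initial_ideal le [set g | g \in G] = initial_ideal le J.

Definition monom_dvd (u v : monom) : Prop := exists w, v = mmul u w.

Definition reduced_groebner_basis (le : rel monom) (J : set poly)
    (G : {fset poly}) : Prop :=
  [/\ groebner_basis le J G,
      forall g, g \in G -> exists2 u, is_initial le g u & g@_u = 1
    & forall g h u v, g \in G -> h \in G -> g <> h ->
        is_initial le g u -> v \in msupp h -> ~ monom_dvd u v].

(* msize f is 1 + the total degree of f if f != 0, and 0 otherwise. *)
Definition basis_degree (G : {fset poly}) : nat :=
  \max_(g <- G) (msize g).-1.

End Groebner.

(* Main.v *)
(** If c_j >= r_1 + ... + r_(m-1) for every j, with all these r_i positive, then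
    row 0 of a point of T_rc can be solved for in terms of the other rows, and
    T_rc is a product of dilated standard simplices.  At a vertex the normal
    cone is cut out by integer forms whose matrix is unitriangular, hence it is
    unimodular.

    Such a polytope may have edges of any lattice length D.  Let q, p, z be the
    points at distance 0, 1, D on one of them.  Then D p = (D - 1) q + z, so
    x_p^D - x_q^(D-1) x_z lies in the toric ideal.  For the lexicographic order
    in which x_q and x_z are the smallest variables and x_p comes right above
    them, every Groebner basis has an element with initial monomial x_p^e,
    e <= D; the toric relations among q, p, z force e = D.  Taking D = m n
    exceeds the bound. *)

Require Import Defs.
From HB Require Import structures.
From mathcomp Require Import all_boot all_order all_algebra.
From mathcomp Require Import fingroup perm finmap.
From mathcomp Require Import boolp classical_sets functions reals.
From mathcomp Require Import cardinality zify ring lra.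
From mathcomp.multinomials Require Import monalg.
From mathcomp.multinomials Require mpoly.
Import (canonicals) mpoly.

Set Implicit Arguments.
Unset Strict Implicit.
Unset Printing Implicit Defensive.

Import Order.TTheory GRing.Theory Num.Theory.

(** * Reduced Groebner bases over finitely many variables *)

Section Dickson.
Context {I : choiceType} (s : seq I) (s_full : forall i, i \in s).
Local Notation monom := {cmonom I}.
Implicit Types (u v w : monom) (S : set monom).

Lemma monom_dvdP u v : monom_dvd u v <-> forall i, u i <= v i.
Proof.
split=> [[w ->] i|le_uv]; first by rewrite cmM leq_addr.
by exists (divcm v u); apply/eqP/cmP => i; rewrite cmM divcmE subnKC.
Qed.

Lemma monom_dvdxx u : monom_dvd u u.
Proof. exact/monom_dvdP. Qed.

Lemma monom_dvd_trans v u w : monom_dvd u v -> monom_dvd v w -> monom_dvd u w.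
Proof.
move=> /monom_dvdP uv /monom_dvdP vw; apply/monom_dvdP => i.
exact: leq_trans (uv i) (vw i).
Qed.

(** Always pick an index at which [f] is minimal on the current tail, then restart just after it.
    Later picks lie in the same tail, so their values are no smaller. *)
Lemma exists_nondecreasing_subseq (f : nat -> nat) :
  exists2 g : nat -> nat, {homo g : a b / a < b} &
    {homo f \o g : a b / a <= b}.
Proof.
have minP N : exists b, N <= b /\ forall j, N <= j -> f b <= f j.
  have exv : exists y, `[< exists2 j, N <= j & f j = y >].
    by exists (f N); apply/asboolP; exists N.
  case: (ex_minnP exv) => y /asboolP[b Nb <-] fb_min; exists b; split=> // j Nj.
  by apply: fb_min; apply/asboolP; exists j.
have [h hP] := choice minP.
pose g := fix g n := if n is n'.+1 then h (g n').+1 else h 0.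
exists g.
  by apply: homo_ltn => [|a]; [exact: ltn_trans | exact: (hP _).1].
apply: homo_leq => [//||a]; first exact: leq_trans.
have lt_g : g a < g a.+1 by exact: (hP _).1.
by case: a lt_g => [|a] lt_g; apply: (hP _).2 => //;
  apply: leq_trans (ltnW lt_g); exact: (hP _).1.
Qed.

(** Divisibility is componentwise, so the subsequence is refined once for each variable listed in
    [s]. *)
Lemma exists_dvd_subseq (f : nat -> monom) :
  exists2 g : nat -> nat, {homo g : a b / a < b} &
    forall a b, a <= b -> monom_dvd (f (g a)) (f (g b)).
Proof.
suff [g g_incr gP] : exists2 g : nat -> nat, {homo g : a b / a < b} &
    forall i, i \in s -> {homo (fun a => f (g a) i) : a b / a <= b}.
  by exists g => // a b ab; apply/monom_dvdP => i; exact: gP.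
elim: (s) => [|i t [g g_incr gP]]; first by exists id.
have [h h_incr hP] := exists_nondecreasing_subseq (fun a => f (g a) i).
exists (g \o h) => [a b ab|j]; first by apply/g_incr/h_incr.
rewrite inE => /orP[/eqP->|jt] a b ab; first exact: hP.
apply: gP => //; move: ab; rewrite leq_eqVlt => /orP[/eqP->//|ab].
by apply/ltnW/h_incr.
Qed.

Lemma exists_dvd_pair (f : nat -> monom) :
  exists a b, a < b /\ monom_dvd (f a) (f b).
Proof.
have [g g_incr gP] := exists_dvd_subseq f.
by exists (g 0), (g 1); split; [exact: g_incr | exact: gP].
Qed.

(** Otherwise every finite part of [S] extends by a monomial that none of its members divides.
    Iterating gives a sequence that contradicts [exists_dvd_pair]. *)
Lemma dickson S : exists2 F : seq monom, (forall u, u \in F -> S u) &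
  forall u, S u -> exists2 v, v \in F & monom_dvd v u.
Proof.
apply: contrapT => noF.
(* The condition on [F] stands inside the existential, so that [choice] applies to all lists; [mone]
   is a dummy value. *)
have next (F : seq monom) : exists u, (forall v, v \in F -> S v) ->
    S u /\ forall v, v \in F -> ~ monom_dvd v u.
  have [FS|FS] := pselect (forall v, v \in F -> S v); last by exists mone.
  apply: contrapT => noU; apply: noF; exists F => // u Su.
  apply: contrapT => noV; apply: noU; exists u => _; split=> // v vF vu.
  by apply: noV; exists v.
have [h hP] := choice next.
pose L := fix L n := if n is n'.+1 then h (L n') :: L n' else [::].
have LS n : forall v, v \in L n -> S v.
  elim: n => //= n IHn v; rewrite inE => /orP[/eqP->|]; last exact: IHn.
  exact: (hP _ IHn).1.
have [a [b [ab]]] := exists_dvd_pair (h \o L).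
apply: (hP _ (LS b)).2; elim: b ab => // b IHb.
rewrite ltnS leq_eqVlt /= inE => /orP[/eqP->|/IHb->]; first by rewrite eqxx.
by rewrite orbT.
Qed.

(** Dickson's lemma is applied to the minimal elements of [S], which form an antichain. By induction
    on the degree, a minimal one lies below each element of [S]. *)
Lemma dickson_antichain S : exists2 F : seq monom,
  (forall u, u \in F -> S u) /\
  {in F &, forall u v, monom_dvd u v -> u = v} &
  forall u, S u -> exists2 v, v \in F & monom_dvd v u.
Proof.
pose S' : set monom := fun u => S u /\ forall v, S v -> monom_dvd v u -> v = u.
have [F FS' FP] := dickson S'.
exists F; first split=> [u /FS'[]//|u v uF vF].
  by apply: (FS' _ vF).2; case: (FS' _ uF).
suff minP u : S u -> exists2 v, S' v & monom_dvd v u.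
  move=> u /minP[v /FP[w wF wv] vu]; exists w => //.
  exact: monom_dvd_trans wv vu.
have [n] := ubnP (mdeg u); elim: n u => // n IHn u; rewrite ltnS => le_un Su.
have [[v [Sv vu neq]]|noV] :=
  pselect (exists v, [/\ S v, monom_dvd v u & v <> u]).
  have ltvu : mdeg v < mdeg u.
    case: vu neq => w -> neq; rewrite mdegM -[X in X < _]addn0 ltn_add2l lt0n.
    by apply/eqP => /mdeg_eq0I w1; apply: neq; rewrite w1 mulm1.
  have [|w S'w wv] := IHn v _ Sv; first exact: leq_trans ltvu le_un.
  by exists w => //; exact: monom_dvd_trans wv vu.
exists u; last exact: monom_dvdxx.
by split=> // v Sv vu; apply: contrapT => neq; apply: noV; exists v.
Qed.

End Dickson.

(** * Multiplication by a monomial *)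

Section MonomialAlgebra.
Context {I : choiceType} {R : comNzRingType}.
Local Open Scope ring_scope.
Implicit Types (u v w : {cmonom I}) (f : {malg R[{cmonom I}]}).

Lemma msuppMU w f v : v \in msupp (<< w >> * f) ->
  exists2 v', v' \in msupp f & v = mmul w v'.
Proof.
move=> /msuppM_le[w' [v' [w'w v'f ->]]]; exists v' => //.
by move: w'w; rewrite msuppU1 in_fset1 => /eqP->.
Qed.

Lemma mmulI w : injective (mmul w : {cmonom I} -> {cmonom I}).
Proof.
move=> u v /eqP/cmP E; apply/eqP/cmP => i; apply/eqP.
by have := E i; rewrite !cmM => /addnI->.
Qed.

Lemma mcoeffMU w f u : (<< w >> * f)@_(mmul w u) = f@_u.
Proof.
rewrite [_ * _]fgmulUg raddf_sum /=.
under eq_bigr do rewrite mcoeffU mul1r (inj_eq (@mmulI w)).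
rewrite -[RHS](congr1 (mcoeff u) (esym (monalgE f))) raddf_sum /=.
by under [RHS]eq_bigr do rewrite mcoeffU.
Qed.

Lemma mkmalgU1_inj u v : << u >> = << v >> :> {malg R[{cmonom I}]} -> u = v.
Proof.
move=> E; have {E} := etrans (esym (mcoeffU u 1 v))
  (etrans (congr1 (mcoeff v) E) (mcoeffUU v 1)).
by case: (u =P v) => [//|_] /esym/eqP; rewrite mulr0n (negPf (oner_neq0 R)).
Qed.

Lemma mkmalgU_CM (c : R) u : << c *g u >> = c%:MP * << u >>.
Proof. by rewrite [RHS]fgmulUU mulr1 mul1m. Qed.

End MonomialAlgebra.

(** * Term orders, normal forms and reduced bases *)

Section GroebnerExistence.
Context {k : fieldType} {I : choiceType} (s : seq I).
Hypothesis s_full : forall i, i \in s.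
Local Notation monom := {cmonom I}.
Local Notation poly := {malg k[{cmonom I}]}.
Variable le : rel monom.
Hypothesis le_term : term_order le.
Implicit Types (u v w : monom) (f g h : poly).

Local Open Scope ring_scope.

Let le_anti : antisymmetric le. Proof. by case: le_term. Qed.
Let le_trans' : transitive le. Proof. by case: le_term. Qed.
Let le_total' : total le. Proof. by case: le_term. Qed.
Let le_refl u : le u u. Proof. by have := le_total' u u; rewrite orbb. Qed.

Lemma monom_dvd_le u v : monom_dvd u v -> le u v.
Proof.
case: le_term => _ _ _ le1 leM [w ->].
by have := leM _ _ u (le1 w); rewrite mul1m mulmC.
Qed.

(** Term orders are well-founded: in an infinite strictly descending chain some term would divide a
    later one, hence lie below it. *)
Lemma term_order_ind (P : monom -> Prop) :
  (forall u, (forall v, le v u -> v <> u -> P v) -> P u) -> forall u, P u.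
Proof.
move=> IH u0; apply: contrapT => nPu0.
have smaller (u : {u | ~ P u}) : exists v : {u | ~ P u},
    le (sval v) (sval u) /\ sval v <> sval u.
  case: u => u nPu /=; apply: contrapT => noV; apply: nPu; apply: IH => v vu neq.
  by apply: contrapT => nPv; apply: noV; exists (exist _ v nPv).
have [h hP] := choice smaller.
pose f n := sval (iter n h (exist _ u0 nPu0)).
have f_decr a b : (a < b)%N -> le (f b) (f a) /\ f b <> f a.
  elim: b => // b IHb; rewrite ltnS leq_eqVlt => /orP[/eqP->|/IHb[ba neq]].
    exact: hP.
  have [bb' neqb] := hP (iter b h (exist _ u0 nPu0)).
  have lebSa : le (f b.+1) (f a) by exact: le_trans' bb' ba.
  split=> // eqba; apply: neq; apply: le_anti; rewrite ba /=.
  by rewrite -eqba.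
have [a [b [ab fab]]] := exists_dvd_pair s_full f.
have [ba neq] := f_decr _ _ ab; apply: neq; apply: le_anti.
by rewrite ba monom_dvd_le.
Qed.

Lemma is_initial_inj f u v : is_initial le f u -> is_initial le f v -> u = v.
Proof.
by move=> [uf fu] [vf fv]; apply: le_anti; rewrite fv // fu.
Qed.

Lemma is_initialMU w f u :
  is_initial le f u -> is_initial le (<< w >> * f) (mmul w u).
Proof.
move=> [uf fu]; split; first by rewrite -mcoeff_neq0 mcoeffMU mcoeff_neq0.
move=> _ /msuppMU[v /fu vu ->]; case: le_term => _ _ _ _ leM.
by rewrite ![mmul w _]mulmC leM.
Qed.

Lemma is_initial_binomial u v : v <> u -> le v u ->
  is_initial le (<< u >> - << v >> : poly) u.
Proof.
move=> neq vu; split.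
  (* Explicit proof terms, here and for the monomials pow and mixed below:
     a rewrite would try to convert distinct monomials into each other. *)
  have v0 : (<< v >> : poly)@_u = 0.
    by apply: etrans (mcoeffU _ _ _) _; case: (v =P u).
  rewrite -mcoeff_neq0; have -> : (<< u >> - << v >> : poly)@_u = 1.
    exact: etrans (mcoeffB _ _ _)
      (etrans (congr2 (fun a b => a - b) (mcoeffUU u 1) v0) (subr0 1)).
  exact: oner_neq0.
move=> w /(fsubsetP (msuppB_le _ _)); rewrite in_fsetU.
by case/orP=> /(fsubsetP msuppU_le); rewrite in_fset1 => /eqP->.
Qed.

Lemma ideal_gen0 (S : set poly) : ideal_gen S 0.
Proof. by exists [::] => //; rewrite big_nil. Qed.

Lemma ideal_genD (S : set poly) f g :
  ideal_gen S f -> ideal_gen S g -> ideal_gen S (f + g).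
Proof.
move=> [s1 s1S ->] [s2 s2S ->]; exists (s1 ++ s2); last by rewrite big_cat.
by move=> p; rewrite mem_cat => /orP[/s1S|/s2S].
Qed.

Lemma ideal_genM (S : set poly) p f : ideal_gen S f -> ideal_gen S (p * f).
Proof.
move=> [t tS ->]; exists [seq (p * q.1, q.2) | q <- t].
  by move=> q /mapP[q' /tS Sq' ->].
by rewrite big_map mulr_sumr; apply: eq_bigr => q _; rewrite mulrA.
Qed.

Lemma ideal_gen_mem (S : set poly) f : S f -> ideal_gen S f.
Proof.
move=> Sf; exists [:: (1, f)]; last by rewrite big_seq1 mul1r.
by move=> p; rewrite inE => /eqP->.
Qed.

Lemma ideal_gen_sub (S S' : set poly) :
  (forall f, S f -> ideal_gen S' f) -> forall f, ideal_gen S f -> ideal_gen S' f.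
Proof.
move=> SS' f [t tS ->]; rewrite big_seq.
elim/big_ind: _ => [|? ?|p /tS /SS']; [exact: ideal_gen0|exact: ideal_genD|].
exact: ideal_genM.
Qed.

(** The monomial [u] must occur in one of the summands, and all monomials of a multiple of [<< v >>]
    are divisible by [v]. *)
Lemma mem_monomial_ideal (t : seq (poly * poly)) u :
  (forall p, p \in t -> exists v, p.2 = << v >>) ->
  << u >> = \sum_(p <- t) p.1 * p.2 ->
  exists v p, [/\ p \in t, p.2 = << v >> & monom_dvd v u].
Proof.
move=> tP E; have neq0 : (\sum_(p <- t) p.1 * p.2)@_u != 0.
  by rewrite -E mcoeffUU oner_eq0.
have [p pt] : exists2 p, p \in t & u \in msupp (p.1 * p.2).
  apply: contrapT => noP; move/negP: neq0; apply.
  rewrite raddf_sum big_seq big1 // => p pt; apply: mcoeff_outdom.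
  by apply/negP => up; apply: noP; exists p.
have [v pv] := tP p pt; rewrite pv mulrC => /msuppMU[w _ ->].
by exists v, p; split=> //; exists w.
Qed.

(** Applied to a single binomial, this later produces the basis element of large degree. *)
Lemma groebner_basis_initial_dvd (J : set poly) (G : {fset poly}) f u :
  groebner_basis le J G -> J f -> is_initial le f u ->
  exists g v, [/\ g \in G, is_initial le g v & monom_dvd v u].
Proof.
move=> [GJ GE] Jf fu.
have : initial_ideal le J << u >> by apply: ideal_gen_mem; exists f, u.
rewrite -GE => -[t tG E].
have tP p : p \in t -> exists v, p.2 = << v >>.
  by move=> /tG[g [v [_ _ ->]]]; exists v.
have [v [p [/tG[g [w [gG gw p2w]] p2v vu]]]] := mem_monomial_ideal tP E.
exists g, v; split=> //; suff -> : v = w by [].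
exact: mkmalgU1_inj (etrans (esym p2v) p2w).
Qed.

Section Ideal.
Variable J : set poly.
Hypothesis J0 : J 0.
Hypothesis JD : forall f g, J f -> J g -> J (f + g).
Hypothesis JM : forall p f, J f -> J (p * f).

Let initials u := exists2 f, J f & is_initial le f u.

Let initials_dvd u v : initials u -> monom_dvd u v -> initials v.
Proof.
move=> [f Jf fu] [w ->]; exists (<< w >> * f); first exact: JM.
by rewrite mulmC; exact: is_initialMU.
Qed.

Lemma monic_initial u : initials u ->
  exists g, [/\ J g, is_initial le g u & g@_u = 1].
Proof.
move=> [f Jf [uf fu]]; have fu0 : f@_u != 0 by rewrite mcoeff_neq0.
exists ((f@_u)^-1%:MP * f); split; first exact: JM.
  split; first by rewrite -mcoeff_neq0 mcoeffCM mulVf // oner_eq0.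
  by move=> v; rewrite -mcoeff_neq0 mcoeffCM mulf_eq0 => /norP[_];
    rewrite mcoeff_neq0 => /fu.
by rewrite mcoeffCM mulVf.
Qed.

(* Reducing single monomials suffices: the tail of an element of J with initial
   monomial u is a combination of smaller monomials. *)
Lemma normal_form u : exists h, [/\ J (<< u >> - h),
  forall v, v \in msupp h -> ~ initials v &
  forall v, v \in msupp h -> le v u].
Proof.
elim/term_order_ind: u => u IH.
have [/monic_initial[g [Jg [ug gu] gu1]]|nu] := pselect (initials u); last first.
  exists << u >>; split; first by rewrite subrr.
    by move=> v; rewrite msuppU1 in_fset1 => /eqP->.
  by move=> v; rewrite msuppU1 in_fset1 => /eqP->.
(* Since [g] is monic with initial monomial [u], the difference only has smaller monomials. *)
pose r := << u >> - g.
have rlt v : v \in msupp r -> le v u /\ v <> u.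
  move=> vr; have neq : v <> u.
    move=> vu; move: vr; rewrite vu -mcoeff_neq0 mcoeffB mcoeffUU gu1.
    by rewrite subrr eqxx.
  split=> //; apply: gu; move: vr; rewrite -!mcoeff_neq0 mcoeffB mcoeffU1.
  by case: (u =P v) neq => [->//|_ _]; rewrite sub0r oppr_eq0.
suff [h [Jh hn hle]] : exists h, [/\ J (r - h),
    forall v, v \in msupp h -> ~ initials v &
    forall v, v \in msupp h -> le v u].
  exists h; split=> //; have -> : << u >> - h = g + (r - h).
    by rewrite /r; ring.
  exact: JD.
suff sumP (t : seq monom) : {subset t <= msupp r} ->
    exists h, [/\ J (\sum_(v <- t) << r@_v *g v >> - h),
    forall v, v \in msupp h -> ~ initials v &
    forall v, v \in msupp h -> le v u].
  rewrite {1}(monalgE r); exact: sumP.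
elim: t => [_|v t IHt sub].
  by exists 0; rewrite big_nil subrr; split=> // v; rewrite msupp0.
have [|h1 [Jh1 h1n h1le]] := IHt.
  by move=> w wt; apply: sub; rewrite inE wt orbT.
have [vu neq] := rlt v (sub v (mem_head _ _)).
have [h2 [Jh2 h2n h2le]] := IH v vu neq.
have memD w : w \in msupp ((r@_v)%:MP * h2 + h1) ->
    w \in msupp h2 \/ w \in msupp h1.
  move/(fsubsetP (msuppD_le _ _)); rewrite in_fsetU => /orP[|]; last by right.
  rewrite -mcoeff_neq0 mcoeffCM mulf_eq0 => /norP[_]; rewrite mcoeff_neq0.
  by left.
exists ((r@_v)%:MP * h2 + h1); split.
- rewrite big_cons mkmalgU_CM opprD addrACA -mulrBr; apply: JD => //; exact: JM.
- by move=> w /memD[/h2n|/h1n].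
- by move=> w /memD[/h2le wv|/h1le//]; exact: le_trans' wv vu.
Qed.

(** Subtract from [<< u >>] its normal form: no initial monomial occurs there, so [u] keeps the
    coefficient 1. *)
Lemma reduced_initial u : initials u -> exists g,
  [/\ J g, is_initial le g u, g@_u = 1 &
      forall v, v \in msupp g -> v <> u -> ~ initials v].
Proof.
move=> uJ; have [h [Jh hn hle]] := normal_form u.
have hu : h@_u = 0 by apply: mcoeff_outdom; apply/negP => /hn.
have gu1 : (<< u >> - h)@_u = 1 by rewrite mcoeffB mcoeffUU hu subr0.
have memg v : v \in msupp (<< u >> - h) -> v <> u -> v \in msupp h.
  rewrite -!mcoeff_neq0 mcoeffB mcoeffU1.
  by case: (u =P v) => [->//|_ + _]; rewrite sub0r oppr_eq0.
exists (<< u >> - h); split=> //; last by move=> v vg /(memg v vg)/hn.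
split; first by rewrite -mcoeff_neq0 gu1 oner_eq0.
by move=> v vg; have [->//|/eqP neq] := eqVneq v u; exact/hle/memg.
Qed.

(** Take one element from [reduced_initial] for each minimal initial monomial; Dickson's lemma makes
    these finitely many. *)
Lemma reduced_groebner_basis_exists :
  exists G : {fset poly}, reduced_groebner_basis le J G.
Proof.
have [F [FJ Fanti] FP] := dickson_antichain s_full initials.
have gP u : exists g, initials u ->
  [/\ J g, is_initial le g u, g@_u = 1 &
      forall v, v \in msupp g -> v <> u -> ~ initials v].
  have [/reduced_initial[g ?]|?] := pselect (initials u); first by exists g.
  by exists 0.
have [g gE] := choice gP.
pose G : {fset poly} := [fset x in [seq g u | u <- F]]%fset.
have inG x : x \in G -> exists2 u, u \in F & x = g u.
  by rewrite inE => /mapP.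
exists G; split.
- split; first by move=> x /inG[u /FJ/gE[Jg _ _ _] ->].
  apply/seteqP; split; apply: ideal_gen_sub => _ [x [u [xJ xu ->]]].
    apply: ideal_gen_mem; exists x, u; split=> //.
    by have [v /FJ/gE[Jg _ _ _] ->] := inG _ xJ.
  have [|v vF [w ->]] := FP u; first by exists x.
  have -> : << mmul v w >> = << w >> * << v >> :> poly.
    by rewrite mulrC [RHS]fgmulUU mulr1.
  apply/ideal_genM/ideal_gen_mem; exists (g v), v.
  have [_ gv _ _] := gE v (FJ v vF); split=> //.
  by rewrite /= inE; apply/mapP; exists v.
- by move=> x /inG[u /FJ/gE[_ gu g1 _] ->]; exists u.
- move=> x y u v /inG[u' u'F ->] /inG[v' v'F ->] neq gu vg uv.
  have [_ gu' _ _] := gE u' (FJ u' u'F).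
  have [_ gv' _ gvn] := gE v' (FJ v' v'F).
  have Euu := is_initial_inj gu gu'; rewrite {}Euu {gu} in uv.
  (* If [v] is the initial monomial of the second element, the antichain property makes both
     elements equal. Otherwise [v] is a tail monomial, hence not initial, although [u'] divides
     it. *)
  have [vv'|/eqP neqv] := eqVneq v v'.
    by apply: neq; rewrite (Fanti u' v') // -vv'.
  by apply: (gvn v vg neqv); exact: initials_dvd (FJ _ u'F) uv.
Qed.

End Ideal.
End GroebnerExistence.

(** * Lexicographic orders *)

Section Lex.
Context {I : choiceType}.
Local Notation monom := {cmonom I}.
Implicit Types (s : seq I) (u v w : monom).

(** The head of [s] is the largest variable. Variables outside [s] are ignored, so antisymmetry
    requires [s] to list all of them. *)
Fixpoint lex_le s u v : bool :=
  if s is i :: t then (u i < v i) || ((u i == v i) && lex_le t u v) else true.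

Lemma lex_le_trans s : transitive (lex_le s).
Proof.
elim: s => //= i s IHs v u w.
move=> /orP[uv|/andP[/eqP<- uv]] /orP[vw|/andP[/eqP<- vw]].
- by rewrite (ltn_trans uv vw).
- by rewrite uv.
- by rewrite vw.
- by rewrite eqxx (IHs _ _ _ uv vw) orbT.
Qed.

Lemma lex_le_total s : total (lex_le s).
Proof.
by elim: s => //= i s IHs u v; case: ltngtP => //= _; rewrite orbC; exact: IHs.
Qed.

Lemma lex_le_anti s u v :
  lex_le s u v -> lex_le s v u -> forall i, i \in s -> u i = v i.
Proof.
elim: s => //= j s IHs; case: ltngtP => //= E uv vu i.
by rewrite inE => /orP[/eqP->//|]; exact: IHs.
Qed.

Lemma lex_le1 s u : lex_le s mone u.
Proof.
elim: s => //= i s IHs; rewrite IHs andbT cm1.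
by case: (u i).
Qed.

Lemma lex_leM s u v w : lex_le s u v -> lex_le s (mmul u w) (mmul v w).
Proof.
elim: s => //= i s IHs; rewrite !cmM ltn_add2r eqn_add2r.
by move=> /orP[->//|/andP[-> /IHs->]]; rewrite orbT.
Qed.

Lemma lex_term_order s : (forall i, i \in s) -> term_order (lex_le s).
Proof.
move=> s_full; split.
- move=> u v /andP[uv vu]; apply/eqP/cmP => i.
  exact: (lex_le_anti uv vu (s_full i)).
- exact: lex_le_trans.
- exact: lex_le_total.
- exact: lex_le1.
- by move=> u v w; exact: lex_leM.
Qed.

(** The elimination property: a polynomial whose initial monomial avoids the leading block [s]
    avoids that block altogether. *)
Lemma lex_le_cat s t u v :
  lex_le (s ++ t) u v -> {in s, forall i, v i = 0} -> {in s, forall i, u i = 0}.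
Proof.
elim: s => //= j s IHs + v0 i; rewrite (v0 j) ?mem_head // ltn0 /=.
move=> /andP[/eqP uj uv]; rewrite inE => /orP[/eqP->//|].
by apply: IHs => // l ls; apply: v0; rewrite inE ls orbT.
Qed.

Lemma lex_le_cat_eq s t u v :
  {in s, forall i, u i = v i} -> lex_le t u v -> lex_le (s ++ t) u v.
Proof.
elim: s => //= j s IHs uv tuv; rewrite uv ?mem_head // eqxx IHs ?orbT // => i si.
by apply: uv; rewrite inE si orbT.
Qed.

Lemma lex_le_lt i t u v : u i < v i -> lex_le (i :: t) u v.
Proof. by move=> /= ->. Qed.

End Lex.
(** * Unimodular cones *)

Section Unimodular.
Context {R : realType} {N : nat}.
Local Open Scope ring_scope.
Local Open Scope classical_set_scope.
Implicit Types (x y phi : 'rV[R]_N) (M : 'M[int]_N) (sigma : set 'rV[R]_N).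

Local Notation realmx M := (map_mx (intr : int -> R) M).

(** The preimage of the standard cone under right multiplication by [M]. *)
Definition matrix_cone (q : nat) M : set 'rV[R]_N :=
  [set x | forall i : 'I_N, (i < q)%N -> 0 <= (x *m realmx M) 0 i].

Lemma realmxM M1 M2 : realmx (M1 *m M2) = realmx M1 *m realmx M2.
Proof. exact: map_mxM. Qed.

Lemma realmx1 : realmx (1%:M : 'M_N) = 1%:M.
Proof. exact: map_mx1. Qed.

Lemma matrix_cone1 q : matrix_cone q 1%:M = @standard_cone R N q.
Proof. by rewrite /matrix_cone realmx1; under eq_set do rewrite mulmx1. Qed.

(** Any [x] is a difference of two points of the cone, [x + p] and [p], where [p] is chosen so that
    its image under [M] has the absolute values of the coordinates of [x *m M]. *)
Lemma lin_matrix_cone q M M' : M' *m M = 1%:M -> lin (matrix_cone q M) = setT.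
Proof.
move=> M'M; apply/seteqP; split=> // x _.
pose z := x *m realmx M; pose p := (\row_i `|z 0 i|) *m realmx M'.
have pM : p *m realmx M = \row_i `|z 0 i|.
  by rewrite /p -mulmxA -realmxM M'M realmx1 mulmx1.
exists [:: x + p; p].
  move=> y; rewrite !inE => /orP[]/eqP-> i _; last by rewrite pM mxE.
  rewrite mulmxDl pM -/z mxE [X in _ + X]mxE -lerBlDl sub0r -normrN.
  exact: ler_norm.
rewrite -[X in X \in _](addrK p x).
by apply: memvB; apply: memv_span; rewrite !inE eqxx ?orbT.
Qed.

(** Both [M] and its inverse are integral, so multiplication by [M] is a bijection of the lattice
    and carries the cone onto the standard one. *)
Lemma unimodular_matrix_cone q M M' : (q <= N)%N ->
  M *m M' = 1%:M -> M' *m M = 1%:M -> unimodular (matrix_cone q M).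
Proof.
move=> leqN MM' M'M; exists N, q.
have linT := lin_matrix_cone q M'M.
have linT' : lin (@standard_cone R N q) = setT.
  by rewrite -matrix_cone1; apply: (@lin_matrix_cone _ _ 1%:M); rewrite mulmx1.
have RMM' : realmx M *m realmx M' = 1%:M by rewrite -realmxM MM' realmx1.
have RM'M : realmx M' *m realmx M = 1%:M by rewrite -realmxM M'M realmx1.
have inj (A : set 'rV[R]_N) : set_inj A (mulmxr (realmx M)).
  move=> x y _ _ /(congr1 (mulmxr (realmx M'))) /=.
  by rewrite -!mulmxA RMM' !mulmx1.
split=> //.
  have : exists2 b : (\dim {:'rV[R]_N}).-tuple 'rV[R]_N, free b &
      setT = [set x : 'rV[R]_N | x \in <<b>>%VS].
    exists (vbasis {:'rV[R]_N}); first exact: basis_free (vbasisP _).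
    by apply/seteqP; split=> // x _ /=; rewrite (span_basis (vbasisP _)) memvf.
  have -> : \dim {:'rV[R]_N} = N by rewrite dimvf /dim /= mul1n.
  by rewrite -linT.
exists (mulmxr (realmx M)); split=> //.
- move=> x /= xz; exists (x *m realmx M'); last by rewrite /= -mulmxA RM'M mulmx1.
  by move=> i; rewrite -mulmxA RM'M mulmx1; exact: xz.
- move=> _ [[a ->] _]; split; last by rewrite linT'.
  by exists (a *m M); rewrite map_mxM.
- move=> _ [[a ->] _]; exists (map_mx intr (a *m M')).
    by split; [exists (a *m M') | rewrite linT].
  by rewrite /= -map_mxM -mulmxA M'M mulmx1.
Qed.

(** The standard cone constrains an initial segment of the coordinates, so those in [Q] have to be
    moved to the front. *)
Lemma exists_perm_initial_segment (Q : pred 'I_N) :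
  exists p : 'S_N, forall i, Q (p i) = (i < #|Q|)%N.
Proof.
pose t := enum Q ++ enum (predC Q).
have : perm_eq t (ord_tuple N).
  apply: uniq_perm; rewrite ?val_ord_tuple ?enum_uniq //.
    rewrite cat_uniq !enum_uniq andbT /=; apply/hasPn => i.
    by rewrite !mem_enum.
  by move=> i; rewrite mem_cat !mem_enum !inE orbN.
move=> /tuple_permP[p tE]; exists p => i.
have -> : p i = nth (p i) t i.
  rewrite tE (nth_map i) ?size_enum_ord // nth_ord_enum.
  by rewrite (tnth_nth (p i)) /= nth_ord_enum.
rewrite nth_cat -cardE; case: ltnP => [lti|lei].
  have := mem_nth (p i) (s := enum Q); rewrite -cardE => /(_ _ lti).
  by rewrite mem_enum.
have szt : (i - #|Q| < size (enum (predC Q)))%N.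
  by rewrite -cardE ltn_subLR // cardC card_ord.
by have := mem_nth (p i) szt; rewrite mem_enum inE => /negbTE.
Qed.

(** Completing the vectors [w l] by standard basis vectors outside [Q] gives a matrix that is
    unitriangular up to a permutation, hence invertible over the integers. *)
Lemma unimodular_unitriangular_cone (Q : pred 'I_N) (w : 'I_N -> 'rV[int]_N) :
  (forall l l', Q l -> Q l' -> w l 0 l' = (l' == l)%:R) ->
  unimodular [set phi : 'rV[R]_N |
    forall l, Q l -> 0 <= pairing phi (map_mx intr (w l))].
Proof.
move=> wQ; have [p pQ] := exists_perm_initial_segment Q.
pose A : 'M[int]_N := \matrix_(i, l) if Q l then w l 0 i else (i == l)%:R.
(* A = 1 + B with B ^ 2 = 0, so 1 - B is an integral inverse of A. *)
pose B := A - 1%:M.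
have BB : B *m B = 0.
  apply/matrixP => i j; rewrite !mxE big1 // => l _; rewrite !mxE.
  case Ql: (Q l); last by rewrite -natrB ?subnn ?mul0r // mulr1n subrr mul0r.
  case Qj: (Q j); last by rewrite subrr mulr0.
  by rewrite (wQ j l) // subrr mulr0.
have AE : A = 1%:M + B by rewrite addrC subrK.
have A1 : (1%:M - B) *m A = 1%:M.
  by rewrite AE mulmxDr mulmx1 mulmxBl mul1mx BB subr0 subrK.
have A2 : A *m (1%:M - B) = 1%:M.
  by rewrite AE mulmxDl mul1mx mulmxBr mulmx1 BB subr0 subrK.
have pp : perm_mx p *m perm_mx p^-1 = 1%:M :> 'M[int]_N.
  by rewrite -perm_mxM mulgV perm_mx1.
have pp' : perm_mx p^-1 *m perm_mx p = 1%:M :> 'M[int]_N.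
  by rewrite -perm_mxM mulVg perm_mx1.
suff -> : [set phi : 'rV[R]_N | forall l, Q l ->
    0 <= pairing phi (map_mx intr (w l))] = matrix_cone #|Q| (col_perm p A).
  apply: (@unimodular_matrix_cone _ _ (perm_mx p *m (1%:M - B))).
  - by rewrite -[leqRHS]card_ord max_card.
  - by rewrite col_permE mulmxA -(mulmxA A) pp' mulmx1.
  - by rewrite col_permE mulmxA -(mulmxA (perm_mx p)) A1 mulmx1.
have entry phi i : Q (p i) -> (phi *m realmx (col_perm p A)) 0 i =
    pairing phi (map_mx intr (w (p i))).
  by move=> Qpi; rewrite mxE; apply: eq_bigr => l _; rewrite !mxE Qpi.
apply/seteqP; split=> phi phiP.
  by move=> i; rewrite -pQ => Qpi; rewrite entry //; exact: phiP.
move=> l Ql; have El : p (p^-1%g l) = l by rewrite permKV.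
by have := entry phi (p^-1%g l); rewrite El => <- //; apply: phiP; rewrite -pQ El.
Qed.

End Unimodular.
(** * Transportation polytopes that are products of simplices *)

Section TransportationPolytope.
Context {R : realType} (m n : nat).
Local Open Scope ring_scope.
Local Open Scope classical_set_scope.
Local Notation idx := (@mxvec_index m.+1 n.+1).
Implicit Types (x v phi : 'rV[R]_(m.+1 * n.+1)).
Implicit Types (i : 'I_m.+1) (j s : 'I_n.+1).

Lemma pairing_vec_mx phi x :
  pairing phi x = \sum_i \sum_j vec_mx phi i j * vec_mx x i j.
Proof.
rewrite /pairing pair_bigA (reindex _ (curry_mxvec_bij m.+1 n.+1)) /=.
by apply: eq_bigr => -[i j] _; rewrite !mxE.
Qed.

Lemma pairing_delta phi i j :
  pairing phi (mxvec (delta_mx i j)) = vec_mx phi i j.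
Proof.
rewrite /pairing mxvec_delta (bigD1 (idx i j)) //= big1 => [|l /negPf nl].
  by rewrite !mxE !eqxx mulr1 addr0.
by rewrite mxE nl andbF mulr0.
Qed.

Lemma pairingDr phi x y : pairing phi (x + y) = pairing phi x + pairing phi y.
Proof.
by rewrite /pairing -big_split; apply: eq_bigr => l _; rewrite mxE mulrDr.
Qed.

Lemma pairingZr phi a x : pairing phi (a *: x) = a * pairing phi x.
Proof.
by rewrite /pairing mulr_sumr; apply: eq_bigr => l _; rewrite mxE mulrCA.
Qed.

Lemma pairingNr phi x : pairing phi (- x) = - pairing phi x.
Proof. by rewrite -scaleN1r pairingZr mulN1r. Qed.

(* The edge direction that moves mass from (i, s) to (i, j) and compensates
   in row 0. *)
Definition exchange_mx (S : pzRingType) i s j : 'M[S]_(m.+1, n.+1) :=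
  delta_mx i j - delta_mx i s - (delta_mx ord0 j - delta_mx ord0 s).

Lemma exchange_mxE (S : pzRingType) i s j i' j' : exchange_mx S i s j i' j' =
  delta_mx i j i' j' - delta_mx i s i' j' -
  (delta_mx ord0 j i' j' - delta_mx ord0 s i' j').
Proof. by rewrite !mxE. Qed.

Lemma pairing_exchange phi i s j :
  pairing phi (mxvec (exchange_mx R i s j)) =
  vec_mx phi i j - vec_mx phi i s - (vec_mx phi ord0 j - vec_mx phi ord0 s).
Proof.
rewrite /exchange_mx !linearB /= !(pairingDr, pairingNr) !pairing_delta.
by rewrite -opprD.
Qed.

Lemma col_sum_delta (S : pzRingType) i j j' :
  \sum_l (delta_mx i j : 'M[S]_(m.+1, n.+1)) l j' = (j' == j)%:R.
Proof.
rewrite (bigD1 i) //= big1 ?addr0 => [|l /negPf nl]; rewrite mxE ?nl //.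
by rewrite eqxx.
Qed.

Lemma row_sum_delta (S : pzRingType) i i' j :
  \sum_l (delta_mx i j : 'M[S]_(m.+1, n.+1)) i' l = (i' == i)%:R.
Proof.
rewrite (bigD1 j) //= big1 ?addr0 => [|l /negPf nl]; rewrite mxE ?nl ?andbF //.
by rewrite eqxx andbT.
Qed.

Variables (r : 'I_m.+1 -> nat) (c : 'I_n.+1 -> nat).
Hypothesis r_gt0 : forall i, i != ord0 -> (0 < r i)%N.
(* Row 0 absorbs every choice of the other rows, so the polytope is a product
   of dilated simplices. *)
Hypothesis c_ge : forall j, (\sum_(i < m.+1 | i != ord0) r i <= c j)%N.
Local Notation T := (@transportation_polytope R _ _ r c).

(** Nonnegativity of row 0 is automatic: by [c_ge] a column sum is at least the sum of the other row
    sums, which bound the other entries of that column. *)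
Lemma transportation_polytopeP x : T x <->
  [/\ forall i j, i != ord0 -> 0 <= vec_mx x i j,
      forall j, \sum_i vec_mx x i j = (c j)%:R &
      forall i, \sum_j vec_mx x i j = (r i)%:R].
Proof.
split=> [[x0 xc xr]|[x0 xc xr]]; first by split=> // i j _; exact: x0.
split=> // i j; have [->|] := eqVneq i ord0; last exact: x0.
have -> : vec_mx x ord0 j = (c j)%:R - \sum_(l < m.+1 | l != ord0) vec_mx x l j.
  by rewrite -(xc j) (bigD1 ord0) //= addrK.
rewrite subr_ge0; apply: (@le_trans _ _ (\sum_(i < m.+1 | i != ord0) r i)%:R).
  rewrite natr_sum; apply: ler_sum => l l0; rewrite -(xr l) (bigD1 j) //=.
  by rewrite lerDl; apply: sumr_ge0 => j' _; exact: x0.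
by rewrite ler_nat.
Qed.

(** Row 0 needs no check by [transportation_polytopeP]; outside it only the entry [(i, s)]
    decreases, by [a]. *)
Lemma exchange_mem x i s j (a : R) : T x -> i != ord0 -> j != s ->
  0 <= a <= vec_mx x i s -> T (x + a *: mxvec (exchange_mx R i s j)).
Proof.
move=> Tx i0 js /andP[a0 ax]; have [x0 xc xr] := Tx.
apply/transportation_polytopeP.
have E i' j' : vec_mx (x + a *: mxvec (exchange_mx R i s j)) i' j' =
    vec_mx x i' j' + a * exchange_mx R i s j i' j'.
  by rewrite linearD linearZ /= mxvecK [LHS]mxE [X in _ + X]mxE.
split=> [i' j' i'0|j'|i']; last 2 first.
- under eq_bigr do rewrite E.
  rewrite big_split /= -mulr_sumr xc.
  under eq_bigr do rewrite exchange_mxE.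
  rewrite !sumrB !col_sum_delta; ring.
- under eq_bigr do rewrite E.
  rewrite big_split /= -mulr_sumr xr.
  under eq_bigr do rewrite exchange_mxE.
  rewrite !sumrB !row_sum_delta; ring.
rewrite E exchange_mxE ![delta_mx _ _ _ _]mxE (negPf i'0) /= !subr0.
have := x0 i' j'.
have [->|] := eqVneq i' i; last by rewrite subrr mulr0 addr0.
have [->|_] := eqVneq j' s.
  by rewrite eq_sym (negPf js) sub0r mulrN1 subr_ge0.
by case: (j' == j) => /= ?; rewrite subr0 ?mulr1 ?mulr0; lra.
Qed.

(** The column sums eliminate row 0: up to a constant, the form only sees the other rows. *)
Lemma pairing_row_reduced phi x : T x -> pairing phi x =
  \sum_j (c j)%:R * vec_mx phi ord0 j +
  \sum_i \sum_j vec_mx x i j * (vec_mx phi i j - vec_mx phi ord0 j).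
Proof.
move=> [_ xc _]; rewrite pairing_vec_mx.
under [X in _ = X + _]eq_bigr do rewrite -xc mulr_suml.
rewrite [X in _ = X + _]exchange_big -big_split; apply: eq_bigr => i _ /=.
by rewrite -big_split; apply: eq_bigr => j _ /=; ring.
Qed.

(** Two positive entries in a row other than row 0 would allow exchanges in two opposite directions,
    and the form minimised only at [v] cannot increase along both. *)
Lemma vertex_columns v : vertex T v -> exists s : 'I_m.+1 -> 'I_n.+1,
  forall i, i != ord0 ->
    vec_mx v i (s i) = (r i)%:R /\ forall j, j != s i -> vec_mx v i j = 0.
Proof.
move=> [Tv [phi vmin]]; have [v0 vc vr] := Tv.
suff /choice[s sP] i : exists s, i != ord0 ->
    vec_mx v i s = (r i)%:R /\ forall j, j != s -> vec_mx v i j = 0.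
  by exists s.
have [_|i0] := eqVneq i ord0; first by exists ord0.
have slope j s : j != s -> 0 < vec_mx v i s ->
    0 < pairing phi (mxvec (exchange_mx R i s j)).
  move=> js vis; have := vmin _ (exchange_mem Tv i0 js (a := vec_mx v i s) _).
  rewrite v0 lexx => /(_ isT); rewrite pairingDr pairingZr ltrDl pmulr_rgt0 //.
  (* The exchanged point differs from [v]: its entry [(i, s)] is 0. *)
  apply=> /(congr1 (fun y => vec_mx y i s)) /eqP.
  rewrite linearD linearZ /= mxvecK [X in X == _]mxE [X in _ + X]mxE.
  rewrite exchange_mxE ![delta_mx _ _ _ _]mxE.
  rewrite !eqxx (negPf i0) [s == j]eq_sym (negPf js) /= subrr subr0 sub0r mulrN1.
  by rewrite subrr => /eqP; lra.
have [s vis] : exists s, 0 < vec_mx v i s.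
  apply: contrapT => nos; have := r_gt0 i0.
  rewrite -(ltr_nat R) -vr big1 ?ltxx //.
  move=> j _; apply/eqP; rewrite -[_ == _]negbK; apply/negP => vij; apply: nos.
  by exists j; rewrite lt_def vij v0.
have vj j : j != s -> vec_mx v i j = 0.
  move=> js; apply/eqP; rewrite -[_ == _]negbK; apply/negP => vij.
  have vij0 : 0 < vec_mx v i j by rewrite lt_def vij v0.
  have := slope _ _ js vis; have := slope s j; rewrite eq_sym => /(_ js vij0).
  rewrite !pairing_exchange; lra.
exists s => _; split=> //.
by rewrite -vr (bigD1 s) //= big1 ?addr0.
Qed.

(** Exchanging the whole mass of a row gives the inequalities. Conversely they say that in each row
    the reduced cost is least at column [s i], where [v] has all its mass. *)
Lemma normal_cone_vertex v (s : 'I_m.+1 -> 'I_n.+1) : T v ->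
  (forall i, i != ord0 ->
    vec_mx v i (s i) = (r i)%:R /\ forall j, j != s i -> vec_mx v i j = 0) ->
  normal_cone T v = [set phi | forall i j, i != ord0 -> j != s i ->
    0 <= pairing phi (mxvec (exchange_mx R i (s i) j))].
Proof.
move=> Tv vs; apply/seteqP; split=> phi /= phiP.
  move=> i j i0 js; have [vi _] := vs i i0.
  have := phiP _ (exchange_mem Tv i0 js (a := vec_mx v i (s i)) _).
  have ri0 : 0 < (r i)%:R :> R by rewrite ltr0n r_gt0.
  rewrite vi ler0n lexx => /(_ isT); rewrite pairingDr pairingZr lerDl.
  by rewrite pmulr_rge0.
move=> x Tx; rewrite !pairing_row_reduced // lerD2l; apply: ler_sum => i _.
have [->|i0] := eqVneq i ord0.
  by rewrite !big1 // => j _; rewrite subrr mulr0.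
have [vi v0] := vs i i0; have [x0 _ xr] := Tx.
rewrite (bigD1 (s i)) //= big1 => [|j js]; last by rewrite v0 ?mul0r.
rewrite addr0 vi -xr mulr_suml; apply: ler_sum => j _.
have [->//|js] := eqVneq j (s i).
have := phiP i j i0 js; rewrite pairing_exchange => le0.
by apply: ler_wpM2l; [exact: x0 | lra].
Qed.

(** Among the cells outside row 0 and off the columns [s i], each edge direction has a single
    nonzero entry, a 1 at its own cell. This is the unitriangularity required of the cone. *)
Lemma smooth_transportation_polytope : smooth T.
Proof.
move=> v vP; have [s vs] := vertex_columns vP.
rewrite (normal_cone_vertex vP.1 vs).
(* The inverse of [mxvec_index]. *)
pose dec (l : 'I_(m.+1 * n.+1)) : 'I_m.+1 * 'I_n.+1 :=
  enum_val (cast_ord (esym (mxvec_cast m.+1 n.+1)) l).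
have decE i j : dec (idx i j) = (i, j).
  by rewrite /dec /mxvec_index cast_ordK enum_rankK.
pose Q l := ((dec l).1 != ord0) && ((dec l).2 != s (dec l).1).
pose w l : 'rV[int]_(m.+1 * n.+1) :=
  mxvec (exchange_mx int (dec l).1 (s (dec l).1) (dec l).2).
have wQ l l' : Q l -> Q l' -> w l 0 l' = (l' == l)%:R.
  case/mxvec_indexP: l => i j; case/mxvec_indexP: l' => i' j'.
  rewrite /Q /w !decE /= => /andP[i0 js] /andP[i'0 j's].
  rewrite mxvecE !mxE (negPf i'0) /= !subr0.
  have -> : (idx i' j' == idx i j) = (i' == i) && (j' == j).
    apply/eqP/andP=> [/(congr1 dec)|[/eqP-> /eqP->]//].
    by rewrite !decE => -[-> ->].
  have [Ei|] //= := eqVneq i' i.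
  by rewrite -Ei (negPf j's) subr0.
suff -> : [set phi : 'rV[R]_(m.+1 * n.+1) |
    forall i j, i != ord0 -> j != s i ->
      0 <= pairing phi (mxvec (exchange_mx R i (s i) j))] =
    [set phi | forall l, Q l -> 0 <= pairing phi (map_mx intr (w l))].
  exact: unimodular_unitriangular_cone wQ.
have wE l : map_mx intr (w l) =
    mxvec (exchange_mx R (dec l).1 (s (dec l).1) (dec l).2).
  by rewrite map_mxvec !map_mxB !map_delta_mx.
apply/seteqP; split=> phi /= phiP.
  by move=> l /andP[l0 ls]; rewrite wE; exact: phiP.
move=> i j i0 js; have := phiP (idx i j).
by rewrite /Q wE decE /= i0 js; apply.
Qed.

End TransportationPolytope.
(** * Toric ideals with long collinear configurations *)

Section VariablePowers.
Context {I : choiceType}.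
Implicit Types (u v : {cmonom I}) (a b : I).

Definition var_pow a (n : nat) : {cmonom I} := [cmonom n | _ in fset1 a]%M.

Lemma var_powE a n b : var_pow a n b = if b == a then n else 0.
Proof. by rewrite cmE fsfun_fun in_fset1. Qed.

Lemma var_pow0 a n b : b != a -> var_pow a n b = 0.
Proof. by rewrite var_powE => /negPf->. Qed.

Lemma leq_mdeg u a : u a <= mdeg u.
Proof.
have [ua|ua] := boolP (a \in finsupp u); last first.
  by rewrite (eqP (_ : u a == 0)) ?cmE_eq0.
by rewrite mdegE (big_fsetD1 a) //= leq_addr.
Qed.

End VariablePowers.

(** * The toric ideal in terms of exponents *)

Section ToricIdeal.
Context {R : realType} {k : fieldType} {N : nat} {P : set 'rV[R]_N}.
Local Notation point := (lattice_pt P).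
Local Notation monom := {cmonom point}.
Local Notation poly := {malg k[{cmonom point}]}.
Variable s : seq point.
Hypotheses (s_uniq : uniq s) (s_full : forall a, a \in s).
Implicit Types (u v w : monom) (f g : poly) (a p q z : point).

Local Open Scope ring_scope.

Lemma monom_imageE u :
  monom_image k u = \prod_(a <- s) laurent_monom k (val a) ^+ u a.
Proof.
rewrite [RHS](bigID (fun a => a \in finsupp u)) /= [X in _ * X]big1 => [|a].
  rewrite mulr1 -big_filter; apply: perm_big.
  apply: uniq_perm; rewrite ?filter_uniq ?fset_uniq // => a.
  by rewrite mem_filter s_full andbT.
by rewrite -cmE_eq0 => /eqP->; rewrite expr0.
Qed.

Lemma monom_image_mmorphism :
  mmorphism (@monom_image R k N P).
Proof.
split=> [u v|]; rewrite !monom_imageE.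
  by rewrite -big_split; apply: eq_bigr => a _; rewrite cmM exprD.
by rewrite big1 // => a _; rewrite cm1 expr0.
Qed.

Let lconst : {rmorphism k -> rational_functions k N} :=
  GRing.RMorphism.clone _ _
    ((@FracField.tofrac _) \o (@mpoly.mpolyC N k)) _.

HB.instance Definition _ := isMultiplicative.Build monom (rational_functions k N)
  (@monom_image R k N P) monom_image_mmorphism.

Lemma toric_ideal0 : toric_ideal k P 0.
Proof. exact: (mmap0 (f := lconst)). Qed.

Lemma toric_idealD f g :
  toric_ideal k P f -> toric_ideal k P g -> toric_ideal k P (f + g).
Proof.
rewrite /toric_ideal /= => f0 g0; rewrite -[RHS](addr0 0) -{1}f0 -g0.
exact: (mmapD (f := lconst)).
Qed.

Lemma toric_idealM f g : toric_ideal k P g -> toric_ideal k P (f * g).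
Proof.
rewrite /toric_ideal /= => g0.
have E : toric_hom (f * g) = toric_hom f * toric_hom g.
  exact: (mmap_is_multiplicative (f := lconst)).1.
by rewrite E g0 mulr0.
Qed.

Lemma toric_homB f g : toric_hom (f - g) = toric_hom f - toric_hom g.
Proof. exact: (mmapB (f := lconst)). Qed.

Lemma toric_homU u : toric_hom (<< u >> : poly) = monom_image k u.
Proof.
rewrite -[RHS]mul1r -(rmorph1 lconst); exact: (mmapU (f := lconst)).
Qed.

Hypothesis P_ge0 : forall a i, 0 <= val a 0 i.

(** By [P_ge0] the absolute value only changes the type, and images of monomials are ordinary
    monomials in the [t_i]. *)
Definition exponent u (i : 'I_N) : nat := (\sum_(a <- s) u a * `|val a 0%R i|)%N.

Lemma exponentM u v i : exponent (mmul u v) i = (exponent u i + exponent v i)%N.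
Proof.
by rewrite /exponent -big_split; apply: eq_bigr => a _; rewrite cmM mulnDl.
Qed.

Lemma exponent_var_pow a n i : exponent (var_pow a n) i = (n * `|val a 0%R i|)%N.
Proof.
rewrite /exponent (bigD1_seq a) //= big1 => [|b /negPf ba].
  by rewrite addn0 var_powE eqxx.
by rewrite var_powE ba.
Qed.

Definition exponent_multinom u : mpoly.multinom N :=
  mpoly.Multinom [tuple exponent u i | i < N].

Lemma monom_image_exponent u : monom_image k u =
  FracField.tofrac (mpoly.mpolyX k (exponent_multinom u)).
Proof.
have monomE a : laurent_monom k (val a) = FracField.tofrac
    (\prod_(i < N) mpoly.mpolyX k (mpoly.mnm1 i) ^+ `|val a 0%R i|%N).
  rewrite rmorph_prod; apply: eq_bigr => i _; rewrite rmorphXn /=.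
  by rewrite -[in LHS](gez0_abs (P_ge0 a i)) -exprnP.
rewrite monom_imageE; under eq_bigr do rewrite monomE -rmorphXn.
rewrite -rmorph_prod; congr FracField.tofrac.
under eq_bigr do rewrite -prodrXl.
rewrite exchange_big /= mpoly.mpolyXE_id; apply: eq_bigr => i _.
rewrite mpoly.multinomE tnth_mktuple -prodrXr.
by apply: eq_bigr => a _; rewrite -exprM mulnC.
Qed.

(* Distinct Laurent monomials are linearly independent, so every term of f is
   cancelled by another one with the same image. *)
Lemma toric_ideal_cancel f u : toric_ideal k P f -> u \in msupp f ->
  exists v, [/\ v \in msupp f, v <> u & forall i, exponent v i = exponent u i].
Proof.
move=> f0 uf; apply: contrapT => noV; move: f0; rewrite /toric_ideal /=.
have -> : toric_hom f = FracField.tofrac (\sum_(v <- msupp f)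
    mpoly.mpolyC N f@_v * mpoly.mpolyX k (exponent_multinom v)).
  rewrite rmorph_sum; apply: eq_bigr => v _.
  by rewrite monom_image_exponent rmorphM.
move=> /eqP; rewrite tofrac_eq0 => /eqP.
move=> /(congr1 (mpoly.mcoeff (exponent_multinom u))).
rewrite mpoly.mcoeff0 raddf_sum /= (bigD1_seq u) ?fset_uniq //= big_seq_cond.
rewrite big1 => [|v /andP[vf /eqP vu]].
  rewrite addr0 mpoly.mcoeffCM mpoly.mcoeffX eqxx mulr1 => /eqP.
  by rewrite mcoeff_eq0 uf.
rewrite mpoly.mcoeffCM mpoly.mcoeffX; case: eqP => [E|]; last by rewrite mulr0.
case: noV; exists v; split=> // i.
have := congr1 (fun M : mpoly.multinom N => tnth (mpoly.multinom_val M) i) E.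
by rewrite /= !tnth_mktuple.
Qed.

Lemma toric_ideal_binomial u v : (forall i, exponent u i = exponent v i) ->
  toric_ideal k P (<< u >> - << v >>).
Proof.
move=> uv; rewrite /toric_ideal /=; apply: etrans (toric_homB _ _) _.
have E : toric_hom (<< u >> : poly) = toric_hom (<< v >> : poly).
  apply: etrans (toric_homU u) (etrans _ (esym (toric_homU v))).
  apply: etrans (monom_image_exponent u) _.
  apply: etrans _ (esym (monom_image_exponent v)).
  congr (FracField.tofrac (mpoly.mpolyX k _)); apply/mpoly.mnmP => i.
  by rewrite !mpoly.multinomE !tnth_mktuple.
exact: etrans (congr2 (fun x y => x - y) E erefl) (subrr _).
Qed.

End ToricIdeal.

(** * Three collinear lattice points *)

Section CollinearPoints.
Context {R : realType} {k : fieldType} {N : nat} {P : set 'rV[R]_N}.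
Local Notation point := (lattice_pt P).
Local Notation monom := {cmonom point}.
Variable s : seq point.
Hypotheses (s_uniq : uniq s) (s_full : forall a, a \in s).
Hypothesis P_ge0 : forall (a : point) i, (0 <= val a 0 i)%R.
(** Coordinate [i] gives the position on the segment, 0 at [q], 1 at [p] and [d] at [z]. Coordinate
    [j] detects [q], which coordinate [i] does not see. *)
Variables (p q z : point) (d : nat) (i j : 'I_N).
Hypothesis d_gt1 : 1 < d.
Hypothesis q_i : (val q 0 i = 0)%R.
Hypothesis p_i : (val p 0 i = 1)%R.
Hypothesis z_i : (val z 0 i = d%:Z)%R.
Hypothesis q_j : (val q 0 j != 0)%R.
Hypothesis p_between : forall l,
  (d%:Z * val p 0 l = d.-1%:Z * val q 0 l + val z 0 l)%R.
Implicit Types (u v w : monom).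

Lemma p_between_coord l :
  d * `|val p 0%R l| = d.-1 * `|val q 0%R l| + 1 * `|val z 0%R l|.
Proof.
apply/eqP; rewrite -eqz_nat PoszD !PoszM mul1r.
by rewrite !gez0_abs ?P_ge0 // p_between.
Qed.

(* The variables are listed from the largest to the smallest. *)
Definition elimination_order : seq point :=
  [seq a <- s | a \notin [:: p; q; z]] ++ [:: p; q; z].

Let pow : monom := var_pow p d.
Let mixed : monom := mmul (var_pow q d.-1) (var_pow z 1).

Let p_q : (p == q) = false.
Proof. by apply/eqP => pq; move: p_i; rewrite pq q_i. Qed.

Let z_q : (z == q) = false.
Proof.
by apply/eqP => zq; move: z_i; rewrite zq q_i => -[d0]; move: d_gt1; rewrite -d0.
Qed.

Let p_z : (p == z) = false.
Proof.
by apply/eqP => pz; move: p_i; rewrite pz z_i => -[d1]; move: d_gt1; rewrite d1.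
Qed.

Lemma elimination_order_full a : a \in elimination_order.
Proof. by rewrite mem_cat mem_filter s_full andbT orNb. Qed.

Lemma elimination_order_perm : perm_eq s elimination_order.
Proof.
apply: uniq_perm => // [|a]; last by rewrite s_full elimination_order_full.
rewrite cat_uniq filter_uniq //=; rewrite !inE p_q p_z [q == z]eq_sym z_q /=.
by rewrite !mem_filter !inE !eqxx !orbT.
Qed.

Let le := lex_le elimination_order.

Lemma elimination_term_order : term_order le.
Proof. exact: lex_term_order elimination_order_full. Qed.

Let p_neq_q : p != q. Proof. by rewrite p_q. Qed.
Let p_neq_z : p != z. Proof. by rewrite p_z. Qed.

Let mixed0 a : a != q -> a != z -> mixed a = 0.
Proof.
move=> aq az.
exact: etrans (cmM _ _ _) (congr2 addn (var_pow0 _ aq) (var_pow0 _ az)).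
Qed.

Let pow_p : pow p = d.
Proof. by apply: etrans (var_powE _ _ _) _; rewrite eqxx. Qed.

Let mixed_neq_pow : mixed <> pow.
Proof.
move=> E; have := etrans (esym (mixed0 p_neq_q p_neq_z))
  (etrans (congr1 (fun u : monom => u p) E) pow_p).
by clear E => d0; move: d_gt1; rewrite -d0.
Qed.

Lemma mixed_le_pow : le mixed pow.
Proof.
apply: lex_le_cat_eq => [a|].
  rewrite mem_filter => /andP[]; rewrite !inE !negb_or => /and3P[ap aq az] _.
  exact: etrans (mixed0 aq az) (esym (var_pow0 _ ap)).
apply: lex_le_lt; apply: leq_ltn_trans (eq_leq (mixed0 p_neq_q p_neq_z)) _.
by apply: leq_trans (ltnW d_gt1) (eq_leq (esym pow_p)).
Qed.

Lemma binomial_initial :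
  is_initial le (<< pow >> - << mixed >> : {malg k[monom]})%R pow.
Proof.
exact (is_initial_binomial elimination_term_order mixed_neq_pow mixed_le_pow).
Qed.

Lemma binomial_toric : toric_ideal k P (<< pow >> - << mixed >>)%R.
Proof.
apply: (toric_ideal_binomial s_uniq s_full P_ge0) => l.
apply: etrans (exponent_var_pow s_uniq s_full p d l) _.
apply: etrans _ (esym (exponentM s _ _ l)).
apply: etrans _ (esym (congr2 addn (exponent_var_pow s_uniq s_full q d.-1 l)
  (exponent_var_pow s_uniq s_full z 1 l))).
exact: p_between_coord.
Qed.

(* Some g in G has initial monomial x_p^e with e <= d, so only x_p, x_q and x_z
   occur in g; another term of g has the same image, and comparing the i-th and
   j-th exponents shows that x_z occurs in it, whence d <= e. *)
Lemma groebner_basis_degree_ge (G : {fset toric_ring k P}) :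
  groebner_basis le (toric_ideal k P) G -> d <= basis_degree G.
Proof.
move=> GB; have [g [u [gG gu /monom_dvdP u_pow]]] :=
  groebner_basis_initial_dvd GB binomial_toric binomial_initial.
have u0 a : a != p -> u a = 0.
  move=> ap; apply/eqP; rewrite -leqn0.
  exact: leq_trans (u_pow a) (eq_leq (var_pow0 d ap)).
have [v [vg vu expE]] := toric_ideal_cancel s_uniq s_full P_ge0 (GB.1 g gG) gu.1.
have v0 : {in [seq a <- s | a \notin [:: p; q; z]], forall a, v a = 0}.
  apply: lex_le_cat (gu.2 v vg) _ => a; rewrite mem_filter !inE !negb_or.
  by move=> /andP[/and3P[ap _ _] _]; exact: u0.
have expv l : exponent s v l =
    v p * `|val p 0%R l| + v q * `|val q 0%R l| + v z * `|val z 0%R l|.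
  rewrite /exponent (perm_big _ elimination_order_perm) big_cat /=.
  rewrite big1_seq => [|a /= /v0->] //.
  by rewrite !big_cons big_nil addn0 add0n addnA.
have expu l : exponent s u l = u p * `|val p 0%R l|.
  rewrite /exponent (bigD1_seq p) //= big1 ?addn0 // => a ap.
  by rewrite u0.
have Ei := expE i; have Ej := expE j; rewrite !expv !expu in Ei Ej.
rewrite p_i q_i z_i absz_nat muln0 addn0 !muln1 in Ei.
(* Without [z], coordinate [i] gives [v p = u p], then coordinate [j] gives [v q = 0], so
   [v = u]. *)
have z_pos : 0 < v z.
  rewrite lt0n; apply/eqP => vz; apply: vu; apply/eqP/cmP => a.
  rewrite vz mul0n !addn0 in Ei Ej.
  have vq : v q = 0.
    move/eqP: Ej; rewrite Ei -[X in _ == X]addn0 eqn_add2l muln_eq0 absz_eq0.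
    by rewrite (negPf q_j) orbF => /eqP.
  have [->//|ap] := eqVneq a p; rewrite (u0 a ap).
  have [->//|aq] := eqVneq a q; have [->//|az] := eqVneq a z.
  by apply: v0; rewrite mem_filter s_full !inE !negb_or ap aq az.
(* Coordinate [i] now reads [v p + v z * d = u p]. *)
have le_du : d <= u p.
  rewrite -Ei; apply: leq_trans (leq_addl _ _).
  by rewrite -[X in X <= _]mul1n leq_mul2r z_pos orbT.
apply: leq_trans le_du _; apply: leq_trans (leq_mdeg u p) _.
rewrite /basis_degree; apply: leq_trans (leq_bigmax_seq _ gG isT).
by have := msize_mdeg_lt gu.1; case: (msize g).
Qed.

End CollinearPoints.
Lemma finite_lattice_points (R : realType) (N K : nat) (P : set 'rV[R]_N) :
  (forall (a : lattice_pt P) l, (0 <= val a 0 l <= K%:Z)%R) ->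
  exists s : seq (lattice_pt P), uniq s /\ forall a, a \in s.
Proof.
move=> bnd; pose f (a : lattice_pt P) : {ffun 'I_N -> 'I_K.+1} :=
  [ffun l => inord `|val a 0%R l|].
have f_inj : injective f.
  move=> a b /ffunP fab; apply/val_inj/rowP => l.
  have /andP[a0 aK] := bnd a l; have /andP[b0 bK] := bnd b l.
  have := congr1 (@nat_of_ord _) (fab l); rewrite !ffunE !inordK ?ltnS -?lez_nat;
    rewrite ?gez0_abs // => E.
  by rewrite -(gez0_abs a0) -(gez0_abs b0) E.
have /finite_fsetP[X XE] : finite_set (f @^-1` setT)%classic.
  by apply: finite_preimage => [a b _ _|]; [exact: f_inj | exact: finite_finset].
exists X; split=> [|a]; first exact: fset_uniq.
by have : (f @^-1` setT)%classic a by []; rewrite XE.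
Qed.

(** * A transportation polytope with a long edge *)

Section LongEdge.
Context {R : realType} (m n D : nat).

(** Row 0 receives what the columns leave: [(n + 2) (m + 1) D - (m + 1) D]. *)
Definition long_row_sum (i : 'I_m.+2) : nat :=
  if i == ord0 then n.+1 * (m.+1 * D) else D.

(** The least column sum that [c_ge] permits, since [m + 1] rows have sum [D]. *)
Definition long_col_sum (j : 'I_n.+2) : nat := m.+1 * D.

Local Notation T :=
  (@transportation_polytope R m.+2 n.+2 long_row_sum long_col_sum).

(* For t = 0, ..., D these are the lattice points of an edge of T: mass t is
   exchanged along the cells (0,0), (0,1), (1,1), (1,0). *)
Definition edge_entry (t i j : nat) : nat :=
  match i, j with
  | 0, 0 => t
  | 0, 1 => m.+1 * D - t
  | 0, _ => m.+1 * D
  | 1, 0 => D - t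
  | 1, 1 => t
  | _, 0 => D
  | _, _ => 0
  end.

Definition edge_vec (t : nat) : 'rV[int]_(m.+2 * n.+2) :=
  mxvec (\matrix_(i, j) Posz (edge_entry t i j)).

Lemma edge_vecE t i j :
  edge_vec t 0%R (mxvec_index i j) = Posz (edge_entry t i j).
Proof. by rewrite mxvecE mxE. Qed.

Lemma sum_ord_rec2 (F : nat -> nat) p :
  \sum_(i < p.+2) F i = F 0 + F 1 + \sum_(i < p) F i.+2.
Proof. by rewrite !big_ord_recl addnA. Qed.

Lemma edge_row_sum t i : t <= D ->
  \sum_(j < n.+2) edge_entry t i j = if i == 0 then n.+1 * (m.+1 * D) else D.
Proof.
move=> tD; rewrite sum_ord_rec2; case: i => [|[|i]] /=;
  rewrite sum_nat_const card_ord; nia.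
Qed.

Lemma edge_col_sum t j : t <= D ->
  \sum_(i < m.+2) edge_entry t i j = m.+1 * D.
Proof.
move=> tD; rewrite (sum_ord_rec2 (edge_entry t ^~ j)); case: j => [|[|j]] /=;
  rewrite sum_nat_const card_ord; nia.
Qed.

Lemma edge_vec_mem t : t <= D -> T (map_mx intr (edge_vec t)).
Proof.
move=> tD; have E i j :
    vec_mx (map_mx intr (edge_vec t) : 'rV[R]_(m.+2 * n.+2)) i j =
    (edge_entry t i j)%:R%R.
  by rewrite mxE mxE edge_vecE.
split=> [i j|j|i]; first by rewrite E ler0n.
  by under eq_bigr do rewrite E; rewrite -natr_sum edge_col_sum.
by under eq_bigr do rewrite E; rewrite -natr_sum edge_row_sum.
Qed.

Definition edge_point t (tD : t <= D) : lattice_pt T :=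
  exist _ (edge_vec t) (asboolT (edge_vec_mem tD)).

Lemma long_lattice_point_bound (a : lattice_pt T) l :
  (0 <= val a 0 l <= (m.+1 * D)%:Z)%R.
Proof.
case: a => a /= /asboolP[a0 ac _]; case/mxvec_indexP: l => i j.
have E i' : vec_mx (map_mx intr a : 'rV[R]__) i' j =
    (a 0%R (mxvec_index i' j))%:~R%R by rewrite !mxE.
apply/andP; split; first by have := a0 i j; rewrite E ler0z.
rewrite -(ler_int R) -E -[X in (_ <= X)%R](ac j) (bigD1 i) //= lerDl.
by apply: sumr_ge0 => i' _; exact: a0.
Qed.

Lemma long_polytope_smooth : 0 < D -> smooth T.
Proof.
move=> D0; apply: smooth_transportation_polytope => [i|j].
  by rewrite /long_row_sum => /negPf->.
rewrite (eq_bigr (fun=> D)) => [|i]; last by rewrite /long_row_sum => /negPf->.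
by rewrite big_mkcond big_ord_recl /= sum_nat_const card_ord.
Qed.

Lemma long_edge_groebner (k : fieldType) : 1 < D ->
  exists le : rel {cmonom (lattice_pt T)},
    [/\ term_order le,
        exists G : {fset toric_ring k T},
          reduced_groebner_basis le (toric_ideal k T) G
      & forall G : {fset toric_ring k T},
          reduced_groebner_basis le (toric_ideal k T) G -> D <= basis_degree G].
Proof.
move=> D1.
have [s [s_uniq s_full]] := finite_lattice_points long_lattice_point_bound.
have T_ge0 (a : lattice_pt T) l : (0 <= val a 0 l)%R.
  by have /andP[] := long_lattice_point_bound a l.
pose p := edge_point (ltnW D1); pose q := edge_point (leq0n D).
pose z := edge_point (leqnn D).
have le_term := elimination_term_order s_full p q z.
exists (lex_le (elimination_order s p q z)); split=> //.
  apply: (reduced_groebner_basis_exists s_full le_term).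
  - exact: toric_ideal0.
  - exact: toric_idealD.
  - exact: toric_idealM s_uniq s_full.
move=> G [GB _ _].
(* Cell (1,1) contains [t] and serves as coordinate [i]; cell (1,0) contains [D - t], nonzero at
   [q], and serves as [j]. *)
pose o1 (h : nat) : 'I_h.+2 := lift ord0 ord0.
apply: (groebner_basis_degree_ge s_uniq s_full T_ge0 (p := p) (q := q) (z := z)
  (i := mxvec_index (o1 m) (o1 n)) (j := mxvec_index (o1 m) ord0)) => //.
- exact: edge_vecE.
- exact: edge_vecE.
- exact: edge_vecE.
- by rewrite edge_vecE /= subn0 eqz_nat -lt0n ltnW.
move=> l; case/mxvec_indexP: l => i j; rewrite !edge_vecE.
rewrite -!PoszM -PoszD; congr Posz.
(* Every entry is affine in [t] for [t <= D], and [D * 1 = (D - 1) * 0 + D]. *)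
by case: (nat_of_ord i) => [|[|i']]; case: (nat_of_ord j) => [|[|j']] /=; nia.
Qed.

End LongEdge.

Theorem mainTheorem8 (R : realType) (k : fieldType) (m n : nat)
    (m_gt0 : 0 < m) (n_gt0 : 0 < n) (m_even : ~~ odd m) (n_even : ~~ odd n) :
  exists (r : 'I_m -> nat) (c : 'I_n -> nat),
    let T : set 'rV[R]_(m * n) := transportation_polytope r c in
    smooth T /\
    exists le : rel {cmonom (lattice_pt T)},
      [/\ term_order le,
          exists G : {fset toric_ring k T},
            reduced_groebner_basis le (toric_ideal k T) G
        & forall G : {fset toric_ring k T},
            reduced_groebner_basis le (toric_ideal k T) G ->
            m * n %/ 2 - m <= basis_degree G].
Proof.
(* Being even and positive, [m] and [n] are at least 2, as the edge requires. *)
case: m m_gt0 m_even => [|[|m']] // _ _.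
case: n n_gt0 n_even => [|[|n']] // _ _.
pose D := m'.+2 * n'.+2.
have D1 : 1 < D by rewrite /D; lia.
exists (@long_row_sum m' n' D), (@long_col_sum m' n' D); split.
  exact/long_polytope_smooth/ltnW.
have [le [le_term GB_ex GB_deg]] := long_edge_groebner (R := R) m' n' k D1.
exists le; split=> // G /GB_deg; apply: leq_trans.
by apply: leq_trans (leq_subr _ _) (leq_div _ _).
Qed.
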